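(* $$\sum_{n\ge0}S_n^{B,+}\frac{x^n}{n!}=\frac{\cos^2x}{\cos x-\sin x},\qquad \sum_{n\ge0}S_n^{B,-}\frac{x^n}{n!}=\frac{\sin^2x}{\cos x-\sin x},$$ $$\sum_{n\ge0}S_n^{D}\frac{x^n}{n!}=\frac{\cos^2x}{\cos x-\sin x},\qquad \sum_{n\ge0}S_n^{B-D}\frac{x^n}{n!}=\frac{\sin^2x}{\cos x-\sin x}.$$
   Context: $\mathfrak{B}_n$ is the group of signed permutations in window notation $\pi=\pi_1\cdots\pi_n$, with $\mathrm{inv}_B(\pi)=|\{i<j:\pi_i>\pi_j\}|+|\{i<j:-\pi_i>\pi_j\}|+|\{i:\pi_i<0\}|$; $\mathfrak{D}_n$ is the subset of $\mathfrak{B}_n$ with an even number of negative entries. A snake of type B is $\pi\in\mathfrak{B}_n$ with $0<\pi_1>\pi_2<\pi_3>\cdots$. For $n\ge1$, $S_n^{B,+}$ (resp. $S_n^{B,-}$) is the number of snakes with $\mathrm{inv}_B$ even (resp. odd), $S_n^D$ the number of snakes in $\mathfrak{D}_n$, and $S_n^{B-D}$ the number of snakes in $\mathfrak{B}_n\setminus\mathfrak{D}_n$. Conventions: $S_0^{B,+}=S_0^D=1$, $S_0^{B,-}=S_0^{B-D}=0$. *)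

(* Defs.v *)
From HB Require Import structures.
From mathcomp Require Import all_boot all_order all_fingroup all_algebra.

Set Implicit Arguments.
Unset Strict Implicit.
Unset Printing Implicit Defensive.

Import Order.TTheory GRing.Theory Num.Theory.
Local Open Scope ring_scope.

(* A signed permutation is a pair (s, e): s gives the absolute values of the
   window and e tells which entries are negative. *)
Definition signed_perm (n : nat) : Type := ('S_n * {ffun 'I_n -> bool})%type.

HB.instance Definition _ n := Finite.on (signed_perm n).

(* Positions and absolute values are numbered from 0 in 'S_n: window p i is the
   entry pi_(i+1), of absolute value (p.1 i).+1. *)
Definition window n (p : signed_perm n) (i : 'I_n) : int :=
  (-1) ^+ p.2 i * (p.1 i).+1%:Z.

Lemma absz_window n (p : signed_perm n) i : `|window p i|%N = (p.1 i).+1.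
Proof. by rewrite /window abszM abszX exp1n mul1n. Qed.

Lemma window_lt0 n (p : signed_perm n) i : (window p i < 0) = p.2 i.
Proof. by rewrite /window; case: (p.2 i); rewrite ?expr1 ?expr0 ?mulN1r ?mul1r. Qed.

Lemma window_inj n : injective (fun p : signed_perm n => [ffun i => window p i]).
Proof.
move=> p q /ffunP eq_pq.
have {}eq_pq i : window p i = window q i by have := eq_pq i; rewrite !ffunE.
case: p q eq_pq => [s e] [t f] eq_w; congr (_, _).
  apply/permP => i; apply/val_inj/succn_inj.
  by rewrite -(absz_window (s, e)) -(absz_window (t, f)) eq_w.
by apply/ffunP => i; rewrite -(window_lt0 (s, e)) -(window_lt0 (t, f)) eq_w.
Qed.

Lemma window_surj n (w : 'I_n -> int) :
  injective (fun i => `|w i|%N) -> (forall i, 0 < `|w i| <= n)%N ->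
  exists p : signed_perm n, window p =1 w.
Proof.
move=> w_inj w_bd.
have lt_w i : (`|w i|.-1 < n)%N by case/andP: (w_bd i) => /prednK->.
have s_inj : injective (fun i => Ordinal (lt_w i)).
  move=> i j /(congr1 val) /= eq_ij; apply: w_inj.
  by case/andP: (w_bd i) => /prednK<- _; case/andP: (w_bd j) => /prednK<- _; rewrite eq_ij.
exists (perm s_inj, [ffun i => w i < 0]) => i.
rewrite /window /= ffunE permE /=; case/andP: (w_bd i) => /prednK-> _.
by case: ltP => w0; rewrite ?mulN1r ?mul1r ?(ltz0_abs w0) ?(gez0_abs w0) ?opprK.
Qed.

Definition invB n (p : signed_perm n) : nat :=
  let w := window p in
  (#|[set ij : 'I_n * 'I_n | (ij.1 < ij.2)%N & (w ij.1 > w ij.2)%R]|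
   + #|[set ij : 'I_n * 'I_n | (ij.1 < ij.2)%N & (- w ij.1 > w ij.2)%R]|
   + #|[set i : 'I_n | (w i < 0)%R]|)%N.

Definition typeD (n : nat) : {set signed_perm n} :=
  [set p : signed_perm n | ~~ odd #|[set i : 'I_n | window p i < 0]|].

(* 0 < pi_1 > pi_2 < pi_3 > ...; with positions numbered from 0 the descents
   are at the even positions. *)
Definition is_snake n (p : signed_perm n) : bool :=
  [forall i : 'I_n, (val i == 0)%N ==> (0 < window p i)] &&
  [forall i : 'I_n, forall j : 'I_n, (val j == (val i).+1)%N ==>
     (if odd i then window p i < window p j else window p i > window p j)].

Definition snakes (n : nat) : {set signed_perm n} := [set p | is_snake p].

Definition SBplus (n : nat) : nat := #|[set p in snakes n | ~~ odd (invB p)]|.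
Definition SBminus (n : nat) : nat := #|[set p in snakes n | odd (invB p)]|.
Definition SD (n : nat) : nat := #|snakes n :&: typeD n|.
Definition SBD (n : nat) : nat := #|snakes n :\: typeD n|.

(* For n = 0 the uniform definitions give the usual conventions. *)
Lemma snakes_conventions :
  [/\ SBplus 0 = 1%N, SD 0 = 1%N, SBminus 0 = 0%N & SBD 0 = 0%N].
Proof.
have set_ord0 (P : pred 'I_0) : #|[set i | P i]| = 0%N.
  by apply: eq_card0 => -[].
have set_ord00 (P : pred ('I_0 * 'I_0)) : #|[set i | P i]| = 0%N.
  by apply: eq_card0 => -[[]].
have inv0 (p : signed_perm 0) : invB p = 0%N.
  by rewrite /invB !set_ord00 set_ord0.
have snake0 (p : signed_perm 0) : is_snake p.
  by apply/andP; split; apply/forallP => -[].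
have card0 : #|[set: signed_perm 0]| = 1%N.
  by rewrite cardsT card_prod card_ffun card_ord card_Sn.
split; rewrite /SBplus /SBminus /SD /SBD -?card0.
- by apply: eq_card => p; rewrite !inE snake0 inv0.
- by apply: eq_card => p; rewrite !inE snake0 set_ord0.
- by apply: eq_card0 => p; rewrite !inE inv0 andbF.
- by apply: eq_card0 => p; rewrite !inE set_ord0.
Qed.

(* Formal power series over the rationals, as coefficient sequences; equality
   of series is extensional equality =1 of these sequences. *)
Definition fps : Type := nat -> rat.

Declare Scope fps_scope.
Delimit Scope fps_scope with fps.
Bind Scope fps_scope with fps.

Definition fps1 : fps := fun n => (n == 0%N)%:R.
Definition fps_sub (F G : fps) : fps := fun n => F n - G n.
Definition fps_mul (F G : fps) : fps :=
  fun n => \sum_(k < n.+1) F k * G (n - k)%N.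
Definition fps_exp (F : fps) (n : nat) : fps := iter n (fps_mul F) fps1.

(* The list of the first n.+1 coefficients b_0, ..., b_n of the inverse of G:
   b_0 = 1 / G_0 and b_m = - (sum_(k < m) G_(m-k) b_k) / G_0 for m > 0. *)
Fixpoint fps_inv_coefs (G : fps) (n : nat) : seq rat :=
  if n is m.+1 then
    let b := fps_inv_coefs G m in
    rcons b (- (\sum_(k < m.+1) G (m.+1 - k)%N * b`_k) / G 0%N)
  else [:: (G 0%N)^-1].

Definition fps_inv (G : fps) : fps := fun n => (fps_inv_coefs G n)`_n.
Definition fps_div (F G : fps) : fps := fps_mul F (fps_inv G).

Definition fps_cos : fps :=
  fun n => if odd n then 0 else (-1) ^+ n./2 / n`!%:R.
Definition fps_sin : fps :=
  fun n => if odd n then (-1) ^+ n./2 / n`!%:R else 0.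

Definition egf (a : nat -> nat) : fps := fun n => (a n)%:R / n`!%:R.

Notation "F - G" := (fps_sub F G) : fps_scope.
Notation "F * G" := (fps_mul F G) : fps_scope.
Notation "F / G" := (fps_div F G) : fps_scope.
Notation "F ^+ n" := (fps_exp F n%N) : fps_scope.

Lemma size_fps_inv_coefs (G : fps) n : size (fps_inv_coefs G n) = n.+1.
Proof. by elim: n => //= n IHn; rewrite size_rcons IHn. Qed.

Lemma nth_fps_inv_coefs (G : fps) n k :
  (k <= n)%N -> (fps_inv_coefs G n)`_k = fps_inv G k.
Proof.
elim: n => [|n IHn]; first by rewrite leqn0 => /eqP->.
rewrite leq_eqVlt => /predU1P[-> //|lt_kn].
by rewrite /= nth_rcons size_fps_inv_coefs lt_kn IHn.
Qed.

(* fps_inv G is the multiplicative inverse of G when G_0 is nonzero, as is the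
   case for G = cos - sin. *)
Lemma fps_mulV (G : fps) : G 0%N != 0 -> fps_mul G (fps_inv G) =1 fps1.
Proof.
move=> G0 [|n]; first by rewrite /fps_mul big_ord1 mulfV.
rewrite /fps_mul (reindex_inj rev_ord_inj) big_ord_recr /=.
rewrite {2}/fps_inv /= !subSS subnn subn0 nth_rcons size_fps_inv_coefs ltnn eqxx.
rewrite [in X in _ + X]mulrC divfK // /fps1 /=.
apply/eqP; rewrite subr_eq0; apply/eqP; apply: eq_bigr => k _.
by rewrite -/(fps_inv_coefs G n) nth_fps_inv_coefs -1?ltnS // subSS subKn // ltnW.
Qed.

Lemma fps_cos_sub_sin0 : (fps_cos - fps_sin)%fps 0%N = 1.
Proof. by rewrite /fps_sub /fps_cos /fps_sin /= expr0 fact0 divr1 subr0. Qed.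

(* Main.v *)
(* Let T be the exponential generating function of all snakes. Removing the last
   entry of a snake and standardizing the others gives Pascal-like recurrences
   for the number of snakes whose last entry, up to the sign (-1)^(n+1), is at
   least c. Solved from c = -n upwards and from c = n + 1 downwards, these
   recurrences give the coefficients of T cos x at c = 0 and of T sin x at
   c = 1. The two counts agree for n > 0, as no entry is 0, whence
   T (cos x - sin x) = 1.
   For the difference of the two classes, switch the sign of an entry that is a
   local minimum of the absolute values and not the first one. This preserves
   snakes and changes the parity of inv_B and of the number of negative entries,
   so that only the snake 1, -2, 3, -4, ... is left, with sign (-1)^(n/2), and
   the difference has generating function cos x + sin x. *)
Require Import Defs.
From mathcomp Require Import all_boot all_order all_fingroup all_algebra.
From mathcomp Require Import zify ring lra.

Set Implicit Arguments.
Unset Strict Implicit.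
Unset Printing Implicit Defensive.

Import Order.TTheory GRing.Theory Num.Theory.
Local Open Scope ring_scope.

(** * Formal power series *)

Lemma eq_fps_mul (F F' G G' : fps) :
  F =1 F' -> G =1 G' -> (F * G)%fps =1 (F' * G')%fps.
Proof. by move=> eqF eqG n; apply: eq_bigr => k _; rewrite eqF eqG. Qed.

(** Coefficient [n] of a product depends only on coefficients up to [n], so commutativity and
    associativity carry over from polynomials. *)
Definition fps_trunc (n : nat) (F : fps) : {poly rat} := \poly_(i < n.+1) F i.

Lemma coef_fps_trunc n F m : (m <= n)%N -> (fps_trunc n F)`_m = F m.
Proof. by move=> le_mn; rewrite coef_poly ltnS le_mn. Qed.

Lemma coef_fps_trunc_mul n F G m :
  (m <= n)%N -> (fps_trunc n F * fps_trunc n G)`_m = (F * G)%fps m.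
Proof.
move=> le_mn; rewrite coefM; apply: eq_bigr => k _.
rewrite !coef_fps_trunc //; first exact: leq_trans (leq_subr _ _) le_mn.
by rewrite (leq_trans _ le_mn) // -ltnS.
Qed.

Lemma fps_mulC (F G : fps) : (F * G)%fps =1 (G * F)%fps.
Proof. by move=> n; rewrite -!(coef_fps_trunc_mul _ _ (leqnn n)) mulrC. Qed.

Lemma fps_mulA (F G H : fps) : (F * (G * H))%fps =1 ((F * G) * H)%fps.
Proof.
move=> n; transitivity ((fps_trunc n F * fps_trunc n G * fps_trunc n H)`_n).
  rewrite -mulrA coefM; apply: eq_bigr => k _.
  by rewrite coef_fps_trunc_mul ?leq_subr // coef_fps_trunc // -ltnS.
rewrite coefM; apply: eq_bigr => k _.
by rewrite coef_fps_trunc_mul ?coef_fps_trunc ?leq_subr // -ltnS.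
Qed.

Lemma fps_mul1r (F : fps) : (F * fps1)%fps =1 F.
Proof.
move=> n; rewrite /fps_mul big_ord_recr /= subnn /fps1 eqxx mulr1.
rewrite big1 ?add0r // => k _.
by rewrite subn_eq0 leqNgt ltn_ord mulr0.
Qed.

Lemma fps_exp2 (F : fps) : (F ^+ 2)%fps =1 (F * F)%fps.
Proof. by apply: eq_fps_mul => //; apply: fps_mul1r. Qed.

Lemma fps_mulDl (F G H : fps) n :
  ((fun n => F n + G n) * H)%fps n = (F * H)%fps n + (G * H)%fps n.
Proof. by rewrite -big_split; apply: eq_bigr => k _; rewrite mulrDl. Qed.

Lemma fps_mulBr (F G H : fps) n :
  (F * (G - H))%fps n = (F * G)%fps n - (F * H)%fps n.
Proof. by rewrite -sumrB; apply: eq_bigr => k _; rewrite mulrBr. Qed.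

Lemma fps_mulZl (a : rat) (F G : fps) n :
  ((fun n => a * F n)%R * G)%fps n = a * (F * G)%fps n.
Proof. by rewrite mulr_sumr; apply: eq_bigr => k _; rewrite mulrA. Qed.

Lemma fps_div_unique (F G H : fps) :
  G 0%N != 0 -> (F * G)%fps =1 H -> F =1 (H / G)%fps.
Proof.
move=> G0 eqH n; rewrite /fps_div -(eq_fps_mul eqH (frefl _)) -fps_mulA.
by rewrite (eq_fps_mul (frefl F) (fps_mulV G0)) fps_mul1r.
Qed.

Lemma divff_fact n k : (k <= n)%N ->
  (k`!%:R)^-1 * ((n - k)`!%:R)^-1 = 'C(n, k)%:R / n`!%:R :> rat.
Proof.
move=> le_kn; rewrite -(bin_fact le_kn) !natrM.
have nz m : m`!%:R != 0 :> rat by rewrite pnatr_eq0 -lt0n fact_gt0.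
have nzC : 'C(n, k)%:R != 0 :> rat by rewrite pnatr_eq0 -lt0n bin_gt0.
by field; rewrite nzC !nz.
Qed.

(** Both products vanish when [k + m] is odd. When [k] and [m] are both odd, [(k + m)./2] exceeds
    [k./2 + m./2] by one, and [(-1) ^+ k] corrects the sign. *)
Lemma cosMDsinM_coef k m :
  fps_cos k * fps_cos m + fps_sin k * fps_sin m =
    (~~ odd (k + m))%:R * (-1) ^+ (k + m)./2 * (-1) ^+ k
      * ((k`!%:R)^-1 * (m`!%:R)^-1).
Proof.
rewrite /fps_cos /fps_sin oddD halfD -[in (-1) ^+ k]signr_odd.
case: (odd k); case: (odd m) => /=; rewrite ?exprD ?expr1 ?expr0.
- by ring.
- by ring.
- by ring.
- by ring.
Qed.

Lemma fps_cos2Dsin2 n :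
  (fps_cos * fps_cos)%fps n + (fps_sin * fps_sin)%fps n = fps1 n.
Proof.
rewrite -big_split /=.
(* The common factor [(-1) ^+ k] turns the convolution into the binomial expansion of
   [(1 - 1) ^+ n]. *)
transitivity ((~~ odd n)%:R * (-1) ^+ n./2 / n`!%:R * (1 - 1) ^+ n : rat).
  rewrite exprBn mulr_sumr; apply: eq_bigr => k _.
  have le_kn : (k <= n)%N by rewrite -ltnS.
  rewrite cosMDsinM_coef subnKC // divff_fact // !expr1n !mulr1 -mulr_natr.
  by ring.
rewrite subrr expr0n /fps1; case: n => [|n] /=; last by rewrite mulr0.
by rewrite expr0 fact0 divr1 !mulr1.
Qed.

(** Multiplied by cos - sin, the two left-hand sides become (1 + (cos^2 - sin^2))/2 and (1 - (cos^2
    - sin^2))/2, which are cos^2 and sin^2 by cos^2 + sin^2 = 1. *)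
Lemma half_secant_egf (T : fps) : (T * (fps_cos - fps_sin))%fps =1 fps1 ->
  (fun n => 2^-1 * (T n + (fps_cos n + fps_sin n)))
    =1 (fps_cos ^+ 2 / (fps_cos - fps_sin))%fps
  /\ (fun n => 2^-1 * (T n + - 1 * (fps_cos n + fps_sin n)))
    =1 (fps_sin ^+ 2 / (fps_cos - fps_sin))%fps.
Proof.
move=> eqT; have G0 : (fps_cos - fps_sin)%fps 0%N != 0.
  by rewrite fps_cos_sub_sin0 oner_eq0.
split; apply: (fps_div_unique G0) => n.
  rewrite fps_mulZl fps_mulDl eqT fps_mulDl !fps_mulBr -fps_cos2Dsin2 fps_exp2.
  by rewrite (fps_mulC fps_sin fps_cos); field.
rewrite fps_mulZl fps_mulDl eqT fps_mulZl fps_mulDl !fps_mulBr -fps_cos2Dsin2.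
by rewrite fps_exp2 (fps_mulC fps_sin fps_cos); field.
Qed.

(** * Counting all snakes by the last entry *)

Lemma signed_perm_eqP n (p q : signed_perm n) : window p =1 window q -> p = q.
Proof.
by move=> eq_pq; apply: window_inj; apply/ffunP => i; rewrite !ffunE.
Qed.

Lemma absz_window_inj n (p : signed_perm n) :
  injective (fun i => `|window p i|%N).
Proof. by move=> i j; rewrite !absz_window => -[/val_inj/perm_inj]. Qed.

(* Value 0 on the empty window, matching the convention that a snake starts
   by rising from 0. *)
Definition last_entry n (p : signed_perm n) : int :=
  \sum_(i < n | i.+1 == n) window p i.

Lemma last_entryE n (p : signed_perm n.+1) : last_entry p = window p ord_max.
Proof.
by rewrite /last_entry (eq_bigl (pred1 ord_max)) ?big_pred1_eq //.
Qed.

Lemma last_entry_bound n (p : signed_perm n) : (`|last_entry p| <= n)%N.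
Proof.
case: n p => [|n] p; first by rewrite /last_entry big_ord0.
by rewrite last_entryE absz_window.
Qed.

Lemma last_entry_eq0 n (p : signed_perm n) : (last_entry p == 0) = (n == 0)%N.
Proof.
case: n p => [|n] p; first by rewrite /last_entry big_ord0.
by rewrite last_entryE -absz_eq0 absz_window.
Qed.

(** This undoes standardization: a strictly increasing map that frees the absolute value [k.+1] for
    a new entry. *)
Definition spread (k : nat) (u : int) : int :=
  if k%:Z < u then u + 1 else if u < - k%:Z then u - 1 else u.

Lemma spread_lt k u v : (spread k u < spread k v) = (u < v).
Proof. by rewrite /spread; do !case: ifP; lia. Qed.

Definition add_last n (k : 'I_n.+1) (b : bool) (p : signed_perm n) :
    signed_perm n.+1 :=
  (lift_perm ord_max k p.1,
   [ffun i => if unlift ord_max i is Some j then p.2 j else b]).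

Lemma window_add_last_max n k b (p : signed_perm n) :
  window (add_last k b p) ord_max = (-1) ^+ b * k.+1%:Z.
Proof. by rewrite /window /= lift_perm_id ffunE unlift_none. Qed.

Lemma window_add_last_lift n k b (p : signed_perm n) i :
  window (add_last k b p) (lift ord_max i) = spread k (window p i).
Proof.
rewrite /window /= lift_perm_lift ffunE liftK /= /bump /spread.
case: (p.2 i); rewrite ?expr1 ?expr0; case: leqP => ?; do !case: ifP; lia.
Qed.

Lemma add_last_inj n k b : injective (@add_last n k b).
Proof.
move=> p q eq_pq; apply: signed_perm_eqP => i.
have: spread k (window p i) = spread k (window q i).
  by rewrite -!(window_add_last_lift k b) eq_pq.
by rewrite /spread; do !case: ifP; lia.
Qed.

Lemma add_last_surj n (k : 'I_n.+1) (b : bool) (p : signed_perm n.+1) :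
  window p ord_max = (-1) ^+ b * k.+1%:Z -> exists q, p = add_last k b q.
Proof.
(* [unspread] inverts [spread k] away from absolute value [k.+1], which the last entry alone has. *)
move=> p_max; pose unspread (u : int) :=
  if k.+1%:Z < u then u - 1 else if u < - k.+1%:Z then u + 1 else u.
have abs_max : `|window p ord_max|%N = k.+1.
  by rewrite p_max abszM abszX exp1n mul1n.
have neq_k i : `|window p (lift ord_max i)|%N != k.+1.
  rewrite -abs_max (inj_eq (@absz_window_inj _ p)) eq_sym; exact: neq_lift.
have bound i : (0 < `|window p i| <= n.+1)%N by rewrite absz_window ltn_ord.
have [||q eq_q] :=
    @window_surj n (fun i => unspread (window p (lift ord_max i))).
- move=> i j; rewrite /unspread => eq_ij; apply: (@lift_inj _ ord_max).
  apply: (@absz_window_inj _ p).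
  move: (neq_k i) (neq_k j) eq_ij.
  move: (bound (lift ord_max i)) (bound (lift ord_max j)).
  by do !case: ifP; lia.
- move=> i; rewrite /unspread.
  by move: (neq_k i) (bound (lift ord_max i)) (ltn_ord k); do !case: ifP; lia.
exists q; apply: signed_perm_eqP => i.
case: (unliftP ord_max i) => [j|] ->; last by rewrite window_add_last_max.
rewrite window_add_last_lift eq_q /unspread /spread.
by move: (neq_k j) (bound (lift ord_max j)); do !case: ifP; lia.
Qed.

Lemma is_snakeP n (p : signed_perm n) :
  reflect ((forall i : 'I_n, i = 0%N :> nat -> 0 < window p i) /\
           (forall i j : 'I_n, j = i.+1 :> nat ->
              if odd i then window p i < window p j
              else window p j < window p i))
          (is_snake p).
Proof.
apply: (iffP andP) => -[fst step]; split.
- by move=> i i0; apply: (implyP (forallP fst i)); apply/eqP.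
- by move=> i j ij; apply: (implyP (forallP (forallP step i) j)); apply/eqP.
- by apply/forallP => i; apply/implyP => /eqP; apply: fst.
- by apply/forallP => i; apply/forallP => j; apply/implyP => /eqP; apply: step.
Qed.

(** The new entry has position [n], so the parity of [n] decides the direction of the last step. For
    [n = 0] the comparison is with [spread k 0 = 0] and expresses the positivity of the first
    entry. *)
Lemma is_snake_add_last n (k : 'I_n.+1) (b : bool) (p : signed_perm n) :
  is_snake (add_last k b p) =
    is_snake p && (if odd n then (-1) ^+ b * k.+1%:Z < spread k (last_entry p)
                   else spread k (last_entry p) < (-1) ^+ b * k.+1%:Z).
Proof.
have lift_val (i : 'I_n) : lift ord_max i = i :> nat.
  by rewrite /= /bump leqNgt ltn_ord.
apply/is_snakeP/andP => -[].
- move=> fst step; split; first (apply/is_snakeP; split).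
  + move=> i i0; have := fst (lift ord_max i); rewrite lift_val => /(_ i0).
    by rewrite window_add_last_lift /spread; do !case: ifP; lia.
  + move=> i j ij; have := step (lift ord_max i) (lift ord_max j).
    by rewrite !window_add_last_lift !lift_val !spread_lt; apply.
  + case: n k p fst step lift_val => [|n] k p fst step lift_val.
      have := fst ord_max erefl; rewrite window_add_last_max.
      by rewrite /last_entry big_ord0 /spread /=; do !case: ifP; lia.
    rewrite last_entryE; have := step (lift ord_max ord_max) ord_max.
    rewrite lift_val window_add_last_lift window_add_last_max => /(_ erefl) /=.
    by case: (odd n).
- move=> /is_snakeP[fst step] cmp; split.
  + move=> i; case: (unliftP ord_max i) => [j|] ->.
      rewrite lift_val => /fst; rewrite window_add_last_lift /spread.
      by do !case: ifP; lia.
    move=> /= n0; move: cmp; rewrite window_add_last_max.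
    have -> : last_entry p = 0 by apply/eqP; rewrite last_entry_eq0 n0.
    by rewrite [in odd n]n0 /spread /=; do !case: ifP; lia.
  + move=> i j; case: (unliftP ord_max i) => [i'|] ->; last first.
      by move=> /= eq_j; have := ltn_ord j; rewrite eq_j ltnn.
    case: (unliftP ord_max j) => [j'|] ->.
      by rewrite !window_add_last_lift !lift_val !spread_lt; apply: step.
    rewrite lift_val window_add_last_lift window_add_last_max => /= eq_n.
    have -> : window p i' = last_entry p; last first.
      by move: cmp; rewrite [in odd n]eq_n /=; case: (odd i').
    rewrite /last_entry (eq_bigl (pred1 i')) ?big_pred1_eq // => x.
    by rewrite inE -val_eqE -[RHS]eqSS -eq_n.
Qed.

(* The sign makes the recurrence of card_snakes_at the same for all n. *)
Definition signed_last n (p : signed_perm n) : int :=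
  (-1) ^+ n.+1 * last_entry p.

Definition snakes_from (n : nat) (c : int) : {set signed_perm n} :=
  [set p in snakes n | c <= signed_last p].

Definition snakes_at (n : nat) (c : int) : {set signed_perm n} :=
  [set p in snakes n | signed_last p == c].

Lemma card_snakes_from n c :
  #|snakes_from n c| = (#|snakes_at n c| + #|snakes_from n (c + 1)|)%N.
Proof.
rewrite -(cardsID [set p | signed_last p == c]); congr (_ + _)%N.
  by apply: eq_card => p; rewrite !inE; case: (p \in snakes n) => //=; lia.
by apply: eq_card => p; rewrite !inE; case: (is_snake p) => //=; lia.
Qed.

Lemma absz_signed_last n (p : signed_perm n) :
  `|signed_last p|%N = `|last_entry p|%N.
Proof. by rewrite abszM abszX exp1n mul1n. Qed.

Lemma snakes_from_all n : snakes_from n (- n%:Z) = snakes n.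
Proof.
apply/setP => p; rewrite inE; case: (p \in snakes n) => //=.
by have := last_entry_bound p; rewrite -absz_signed_last; lia.
Qed.

Lemma snakes_from_none n : snakes_from n (n%:Z + 1) = set0.
Proof.
apply/setP => p; rewrite !inE andbC.
by have := last_entry_bound p; rewrite -absz_signed_last; lia.
Qed.

(** Entries are nonzero, so only the empty window has last entry 0. *)
Lemma card_snakes_at0 n : #|snakes_at n 0| = (n == 0)%N.
Proof.
have eq0 p : (p \in snakes_at n 0) = (p \in snakes n) && (n == 0)%N.
  by rewrite inE -absz_eq0 absz_signed_last absz_eq0 last_entry_eq0.
have [n0|n_neq0] := eqVneq n 0%N; last first.
  by apply: eq_card0 => p; rewrite eq0 (negPf n_neq0) andbF.
subst n; have [_ SD0 _ SBD0] := snakes_conventions.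
have -> : #|snakes_at 0 0| = (SD 0 + SBD 0)%N; last by rewrite SD0 SBD0.
rewrite /SD /SBD (cardsID (typeD 0) (snakes 0)).
by apply: eq_card => p; rewrite eq0 eqxx andbT.
Qed.

(** Delete the last entry. If c is the signed last entry of the long snake and s that of the short
    one, the last step of the snake says -c < [spread k s] for either parity of [n]. This means k <
    s when c = -(k+1), and -k <= s when c = k+1. *)
Lemma card_snakes_at n (k : 'I_n.+1) (b : bool) :
  #|snakes_at n.+1 ((-1) ^+ b * k.+1%:Z)|
    = #|snakes_from n (if b then k.+1%:Z else - k%:Z)|.
Proof.
(* At length [n.+1] the signed last entry is [(-1) ^+ n] times the last entry, hence the sign bit
   [odd n (+) b]. *)
rewrite -(card_imset _ (@add_last_inj n k (odd n (+) b))).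
have sgnE : (-1) ^+ (odd n (+) b) = (-1) ^+ n * (-1) ^+ b :> int.
  by rewrite signr_addb signr_odd.
have condE (q : signed_perm n) :
    (if odd n then (-1) ^+ (odd n (+) b) * k.+1%:Z < spread k (last_entry q)
     else spread k (last_entry q) < (-1) ^+ (odd n (+) b) * k.+1%:Z)
    = ((if b then k.+1%:Z else - k%:Z) <= signed_last q).
  rewrite /signed_last exprS -[in (-1) ^+ n]signr_odd /spread.
  case: (odd n) b {sgnE} => -[];
    by rewrite /= ?expr1 ?expr0; do !case: ifP; lia.
apply: eq_card => p; rewrite inE.
apply/andP/imsetP => [[p_snake p_last]|[q]].
  have /add_last_surj[q eq_p] :
      window p ord_max = (-1) ^+ (odd n (+) b) * k.+1%:Z.
    rewrite sgnE -mulrA -(eqP p_last) /signed_last last_entryE.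
    by rewrite !exprS !mulN1r opprK signrMK.
  by exists q => //; move: p_snake; rewrite eq_p !inE is_snake_add_last condE.
rewrite !inE => /andP[q_snake q_last] ->.
rewrite is_snake_add_last condE q_snake q_last; split=> //.
rewrite /signed_last last_entryE window_add_last_max sgnE.
by rewrite !exprS !mulN1r opprK -mulrA signrMK.
Qed.

(** * Solution of the recurrences by binomial sums *)

Lemma bin_transformS (R : pzRingType) (f : nat -> R) j :
  \sum_(l < j.+2) f l *+ 'C(j.+1, l) =
    \sum_(l < j.+1) f l *+ 'C(j, l) + \sum_(l < j.+1) f l.+1 *+ 'C(j, l).
Proof.
rewrite big_ord_recl; under eq_bigr => l _ do rewrite binS mulrnDr.
rewrite big_split /= addrA; congr (_ + _).
rewrite [in LHS]big_ord_recr /= (bin_small (ltnSn j)) mulr0n addr0.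
by rewrite [RHS]big_ord_recl !bin0.
Qed.

(** This is cos' = - sin, read on the coefficients of x^n/n!; the next lemma is sin' = cos. *)
Lemma cos_coefS n : n.+1`!%:R * fps_cos n.+1 = - (n`!%:R * fps_sin n).
Proof.
have nz m : m`!%:R != 0 :> rat by rewrite pnatr_eq0 -lt0n fact_gt0.
rewrite /fps_cos /fps_sin /= uphalf_half; case: (odd n) => /=.
  by rewrite add1n exprS mulN1r; field; rewrite !nz.
by rewrite !mulr0 oppr0.
Qed.

Lemma sin_coefS n : n.+1`!%:R * fps_sin n.+1 = n`!%:R * fps_cos n.
Proof.
have nz m : m`!%:R != 0 :> rat by rewrite pnatr_eq0 -lt0n fact_gt0.
rewrite /fps_cos /fps_sin /= uphalf_half; case: (odd n) => /=.
  by rewrite !mulr0.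
by rewrite add0n; field; rewrite !nz.
Qed.

(** Here [j] is the distance of the threshold from -n, where all snakes count, or from n + 1, where
    none does. Each recurrence feeds one family into the other, just as differentiation exchanges
    cos and sin up to sign. *)
Lemma snakes_from_bin j n : (j <= n)%N ->
  #|snakes_from n (j%:Z - n%:Z)|%:R =
    \sum_(l < j.+1) (l`!%:R * fps_cos l * #|snakes (n - l)|%:R) *+ 'C(j, l)
  /\ #|snakes_from n (n%:Z - j%:Z + 1)|%:R =
    \sum_(l < j.+1) (l`!%:R * fps_sin l * #|snakes (n - l)|%:R) *+ 'C(j, l).
Proof.
elim: j n => [n _|j IHj [|n] // le_jn].
  rewrite (_ : 0%N%:Z = 0) // !big_ord1 subr0 sub0r snakes_from_all.
  rewrite snakes_from_none cards0.
  by rewrite /fps_cos /fps_sin /= mulr0 mul0r expr0 fact0 divr1 !mul1r subn0.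
have [IHcos IHsin] := IHj n.+1 (leqW le_jn).
have [{IHj}IHcos' IHsin'] := IHj n le_jn.
(* Passing from [j] to [j.+1] at length [n.+1] adds or removes the snakes with signed last entry
   -(n-j+1) in the first family and n-j+1 in the second. *)
have lt_k : (n - j < n.+1)%N by rewrite ltnS leq_subr.
have at_cos := @card_snakes_at n (Ordinal lt_k) true.
have at_sin := @card_snakes_at n (Ordinal lt_k) false.
move: at_cos at_sin; rewrite /= expr1 expr0 mulN1r mul1r => at_cos at_sin.
pose f (G : fps) l := l`!%:R * G l * #|snakes (n.+1 - l)|%:R.
(* Pascal's rule leaves the sum for [j] at length [n.+1] plus a shifted sum, which the derivative
   rules turn into the other family at length [n]. *)
rewrite (bin_transformS (f fps_cos)) (bin_transformS (f fps_sin)) /f.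
rewrite -IHcos -IHsin; split.
  rewrite card_snakes_from (_ : j%:Z - n.+1%:Z = - (n - j).+1%:Z); last by lia.
  rewrite at_cos (_ : - (n - j).+1%:Z + 1 = j.+1%:Z - n.+1%:Z); last by lia.
  rewrite (_ : (n - j).+1%:Z = n%:Z - j%:Z + 1); last by lia.
  rewrite natrD IHsin' addrAC -big_split big1 ?add0r // => l _.
  by rewrite /= cos_coefS subSS mulNr mulNrn addrN.
rewrite (_ : n.+1%:Z - j.+1%:Z + 1 = (n - j).+1%:Z); last by lia.
rewrite (card_snakes_from n.+1 (n - j).+1%:Z).
rewrite at_sin (_ : (n - j).+1%:Z + 1 = n.+1%:Z - j%:Z + 1); last by lia.
rewrite (_ : - (n - j)%N%:Z = j%:Z - n%:Z); last by lia.
rewrite natrD IHcos' addrC; congr (_ + _); apply: eq_bigr => l _.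
by rewrite sin_coefS subSS.
Qed.

Lemma egf_snakes :
  (egf (fun n => #|snakes n|) * (fps_cos - fps_sin))%fps =1 fps1.
Proof.
move=> n; rewrite fps_mulC.
have [eq_cos eq_sin] := snakes_from_bin (leqnn n).
have nz m : m`!%:R != 0 :> rat by rewrite pnatr_eq0 -lt0n fact_gt0.
(* For [j = n] the two thresholds are 0 and 1, so the difference counts the snakes with last entry
   0. *)
transitivity ((#|snakes_from n 0|%:R - #|snakes_from n 1|%:R) / n`!%:R : rat).
  have := eq_cos; rewrite subrr => ->.
  have := eq_sin; rewrite subrr add0r => ->.
  rewrite -sumrB mulr_suml; apply: eq_bigr => l _.
  have le_ln : (l <= n)%N by rewrite -ltnS.
  rewrite /egf /fps_sub -mulrnBl -[_ *+ 'C(n, l)]mulr_natr -(bin_fact le_ln).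
  rewrite !natrM.
  have nzC : 'C(n, l)%:R != 0 :> rat by rewrite pnatr_eq0 -lt0n bin_gt0.
  by field; rewrite nzC !nz.
rewrite (card_snakes_from n 0) add0r natrD addrK card_snakes_at0 /fps1.
by case: n {eq_cos eq_sin} => [|n]; rewrite ?fact0 ?divr1 ?mul0r.
Qed.

(** * The sign-reversing involution *)

Definition toggle_sign n (j : 'I_n) (p : signed_perm n) : signed_perm n :=
  (p.1, [ffun i => (i == j) (+) p.2 i]).

Lemma toggle_signK n (j : 'I_n) : involutive (toggle_sign j).
Proof.
by move=> [s e]; congr (_, _); apply/ffunP => i; rewrite !ffunE addKb.
Qed.

Lemma window_toggle_neq n (j : 'I_n) p i :
  i != j -> window (toggle_sign j p) i = window p i.
Proof. by rewrite /window /= ffunE => /negPf->. Qed.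

Lemma window_toggle n (j : 'I_n) p :
  window (toggle_sign j p) j = - window p j.
Proof.
rewrite /window /= ffunE eqxx.
by case: (p.2 j); rewrite /= ?mulN1r ?mul1r ?opprK.
Qed.

(* At a local minimum of the absolute values other than the first entry, the
   comparisons with the neighbours are decided by the neighbours' signs. *)
Lemma is_snake_toggle n (j : 'I_n) (p : signed_perm n) :
  (0 < j)%N ->
  (forall i : 'I_n, (j == i.+1 :> nat) || (i == j.+1 :> nat) ->
     p.1 j < p.1 i)%N ->
  is_snake (toggle_sign j p) = is_snake p.
Proof.
move=> j_gt0 min_j.
suff sub (q : signed_perm n) :
    q.1 = p.1 -> is_snake q -> is_snake (toggle_sign j q).
  by apply/idP/idP => /sub; rewrite ?toggle_signK; apply.
move=> eq_pq /is_snakeP[fst step]; apply/is_snakeP; split.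
  move=> i i0; rewrite window_toggle_neq; first exact: fst.
  by apply: contraTneq j_gt0 => <-; rewrite i0.
have small (i : 'I_n) : (j == i.+1 :> nat) || (i == j.+1 :> nat) ->
    (`|window q j| < `|window q i|)%N.
  by rewrite !absz_window eq_pq ltnS; apply: min_j.
move=> i k ik; have := step i k ik.
have [eq_ij|neq_ij] := eqVneq i j.
  subst i; have neq_kj : k != j.
    by apply/eqP => eq_kj; move: ik; rewrite eq_kj; lia.
  rewrite window_toggle window_toggle_neq //.
  have := small k; rewrite ik eqxx orbT => /(_ isT).
  by case: (odd j); lia.
have [eq_kj|neq_kj] := eqVneq k j; last by rewrite !window_toggle_neq.
subst k; rewrite window_toggle window_toggle_neq //.
have := small i; rewrite ik eqxx => /(_ isT).
by case: (odd i); lia.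
Qed.

(** Let [k] be the least point moved by [s]. All smaller points are fixed, so the value [k] is taken
    at some [j] after position [k]. The neighbours of [j] then have positions at least [k], hence
    values above [k]. *)
Lemma exists_local_min n (s : 'S_n) : s != 1%g ->
  exists2 j : 'I_n, (0 < j)%N &
    forall i : 'I_n, (j == i.+1 :> nat) || (i == j.+1 :> nat) -> (s j < s i)%N.
Proof.
move=> s_neq1.
have [k0 k0P] : exists k : 'I_n, s k != k.
  apply/existsP; apply: contraNT s_neq1; rewrite negb_exists => /forallP fix_s.
  apply/eqP/permP => k; rewrite perm1; apply/eqP.
  by rewrite -[_ == _]negbK fix_s.
case: (@arg_minnP _ k0 (fun k => s k != k) (@nat_of_ord n) k0P) => k kP min_k.
have fix_lt (i : 'I_n) : (i < k)%N -> s i = i.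
  by rewrite ltnNge => lt_ik; apply/eqP; apply: contraNT lt_ik => /min_k.
have s_ge (i : 'I_n) : (k <= i)%N -> (k <= s i)%N.
  rewrite (leqNgt k i) (leqNgt k (s i)); apply: contra => lt_sk.
  by rewrite -(perm_inj (fix_lt _ lt_sk)).
pose j := (s^-1)%g k; have sj : s j = k by rewrite permKV.
have j_neq : j != k by apply: contraNneq kP => jk; rewrite -[in s k]jk sj.
have lt_kj : (k < j)%N.
  case: (ltngtP k j) => // [lt_jk|/val_inj eq_kj].
    by move: j_neq; rewrite -sj fix_lt ?eqxx.
  by rewrite eq_kj eqxx in j_neq.
exists j => [|i adj]; first exact: leq_ltn_trans lt_kj.
rewrite sj ltn_neqAle s_ge ?andbT; last by move: lt_kj adj; lia.
rewrite -sj (inj_eq val_inj) (inj_eq perm_inj) -val_eqE /=.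
by move: adj; lia.
Qed.

Definition alternating_signs n : signed_perm n :=
  (1%g, [ffun i : 'I_n => odd i]).

(** When the absolute values increase, each comparison is decided by the sign of its right-hand
    entry, so all signs are forced. *)
Lemma is_snake_id n (p : signed_perm n) : p.1 = 1%g ->
  is_snake p = (p == alternating_signs n).
Proof.
case: p => s e /= ->; have winE (f : {ffun 'I_n -> bool}) i :
    window (1%g : 'S_n, f) i = (-1) ^+ f i * i.+1%:Z.
  by rewrite /window perm1.
apply/is_snakeP/eqP => [[fst step]|-> ].
  congr (_, _); apply/ffunP => -[[|i] lt_in]; rewrite ffunE.
    have := fst (Ordinal lt_in) erefl; rewrite winE /=.
    by case: (e _) => //; rewrite expr1; lia.
  have := step (Ordinal (ltnW lt_in)) (Ordinal lt_in) erefl; rewrite !winE /=.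
  case: (odd i); case: (e _); case: (e _) => //=; rewrite ?expr1 ?expr0; lia.
split=> [i i0|i j ij]; rewrite !winE !ffunE ?i0 // ij /=.
by case: (odd i); rewrite /= ?expr1 ?expr0; lia.
Qed.

(** Stated for any [chi] that every sign change flips, so as to serve both for inv_B and for the
    number of negative entries. *)
Lemma card_snakes_parity n (chi : signed_perm n -> bool) :
    (forall j p, chi (toggle_sign j p) = ~~ chi p) ->
    chi (alternating_signs n) = odd n./2 ->
  #|[set p in snakes n | ~~ chi p]|%:R - #|[set p in snakes n | chi p]|%:R
    = (-1) ^+ n./2 :> rat.
Proof.
move=> chi_toggle chi_alt.
transitivity (\sum_(p | is_snake p) (-1) ^+ chi p : rat).
  rewrite (bigID chi) /= addrC -!sum1_card !natr_sum -sumrN.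
  congr (_ + _); rewrite big_mkcond [RHS]big_mkcond; apply: eq_bigr => p _;
    rewrite !inE; case: (is_snake p); case: (chi p) => //=.
pose F (s : 'S_n) := \sum_(e | is_snake (s, e)) (-1) ^+ chi (s, e) : rat.
transitivity (\sum_s F s).
  rewrite /F pair_big_dep /=; apply: eq_big => [[s e]|[s e] _] //.
rewrite (bigD1 1%g) //= [X in _ + X]big1 ?addr0 => [|s s_neq1].
  rewrite /F (eq_bigl (pred1 (alternating_signs n).2)); last first.
    by move=> e; rewrite is_snake_id // xpair_eqE eqxx.
  by rewrite big_pred1_eq -[RHS]signr_odd -chi_alt.
(* The position [j] depends on [s] alone, so toggling there is an involution of the sign vectors
   over [s], and it negates every term of [F s]. *)
have [j j_gt0 min_j] := exists_local_min s_neq1.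
pose tog (e : {ffun 'I_n -> bool}) := (toggle_sign j (s, e)).2.
have togK : involutive tog.
  by move=> e; apply/ffunP => i; rewrite !ffunE addKb.
suff: F s = - F s by lra.
rewrite {1}/F (reindex_inj (inv_inj togK)) -sumrN.
apply: eq_big => [e|e _].
  exact: (@is_snake_toggle _ j (s, e)).
by rewrite (chi_toggle j (s, e)) signrN.
Qed.

(** * Parity of the number of negative entries and of inv_B *)

Definition negs n (p : signed_perm n) : nat := #|[set i | window p i < 0]|.

Lemma negsE n (p : signed_perm n) : negs p = (\sum_i p.2 i)%N.
Proof.
rewrite /negs -sum1dep_card big_mkcond /=; apply: eq_bigr => i _.
by rewrite window_lt0; case: (p.2 i).
Qed.

Lemma odd_negs_toggle n (j : 'I_n) p :
  odd (negs (toggle_sign j p)) = ~~ odd (negs p).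
Proof.
rewrite !negsE !(bigD1 (P := predT) j) //= !oddD ffunE eqxx.
under eq_bigr => i /negPf i_neq do rewrite ffunE i_neq.
by case: (p.2 j) => //=; rewrite negbK.
Qed.

Lemma negs_alternating n : negs (alternating_signs n) = n./2.
Proof.
rewrite negsE; under eq_bigr do rewrite ffunE; elim: n => [|n IHn].
  by rewrite big_ord0.
by rewrite big_ord_recr /= IHn uphalf_half addnC.
Qed.

(* A pair with |w i| > |w j| lies in exactly one of the two inversion sets, a
   pair with |w i| < |w j| in both or in none. *)
Lemma odd_invB n (p : signed_perm n) :
  odd (invB p) =
  odd (\sum_(ij : 'I_n * 'I_n | (ij.1 < ij.2)%N) (p.1 ij.2 < p.1 ij.1))
    (+) odd (negs p).
Proof.
rewrite /invB oddD; congr (_ (+) _).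
rewrite -!sum1dep_card !big_mkcondr -big_split /=.
elim/big_rec2: _ => // ij a b lt_ij IH; rewrite !oddD IH; congr (_ (+) _).
have neq_ij : `|window p ij.1|%N != `|window p ij.2|%N.
  rewrite (inj_eq (@absz_window_inj _ p)).
  by apply: contraTneq lt_ij => ->; rewrite ltnn.
have -> : (p.1 ij.2 < p.1 ij.1)%N = (`|window p ij.2| < `|window p ij.1|)%N.
  by rewrite !absz_window ltnS.
by move: neq_ij; do !case: ifP; case: ltnP; lia.
Qed.

(** By [odd_invB], the signs affect the parity of inv_B only through [negs]. *)
Lemma odd_invB_toggle n (j : 'I_n) p :
  odd (invB (toggle_sign j p)) = ~~ odd (invB p).
Proof. by rewrite !odd_invB odd_negs_toggle addbN. Qed.

Lemma odd_invB_alternating n : odd (invB (alternating_signs n)) = odd n./2.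
Proof.
rewrite odd_invB negs_alternating big1 // => ij lt_ij.
by rewrite !perm1 ltnNge ltnW.
Qed.

(** Since cos x + sin x has x^n/n! coefficient [(-1) ^+ n./2], the values of [a] and [b] are the
    half-sum and half-difference of the snake count and this sign. *)
Lemma egf_snakes_parity (a b : nat -> nat) :
    (forall n, a n + b n = #|snakes n|)%N ->
    (forall n, (a n)%:R - (b n)%:R = (-1) ^+ n./2 :> rat) ->
  egf a =1 (fps_cos ^+ 2 / (fps_cos - fps_sin))%fps
  /\ egf b =1 (fps_sin ^+ 2 / (fps_cos - fps_sin))%fps.
Proof.
move=> sum_ab diff_ab; have [eq_a eq_b] := half_secant_egf egf_snakes.
have cosDsin n : fps_cos n + fps_sin n = ((a n)%:R - (b n)%:R) / n`!%:R.
  by rewrite diff_ab /fps_cos /fps_sin; case: (odd n); rewrite ?add0r ?addr0.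
split=> n; rewrite -?eq_a -?eq_b cosDsin /egf -sum_ab natrD.
  by field; rewrite pnatr_eq0 -lt0n fact_gt0.
by field; rewrite pnatr_eq0 -lt0n fact_gt0.
Qed.

Theorem theorem65 :
  [/\ egf SBplus =1 (fps_cos ^+ 2 / (fps_cos - fps_sin))%fps,
      egf SBminus =1 (fps_sin ^+ 2 / (fps_cos - fps_sin))%fps,
      egf SD =1 (fps_cos ^+ 2 / (fps_cos - fps_sin))%fps
    & egf SBD =1 (fps_sin ^+ 2 / (fps_cos - fps_sin))%fps].
Proof.
have split_parity n (chi : signed_perm n -> bool) :
    (#|[set p in snakes n | ~~ chi p]| + #|[set p in snakes n | chi p]|
       = #|snakes n|)%N.
  rewrite addnC -(cardsID [set p | chi p] (snakes n)); congr (_ + _)%N.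
    by apply: eq_card => p; rewrite !inE.
  by apply: eq_card => p; rewrite !inE andbC.
have [||egf_plus egf_minus] := @egf_snakes_parity SBplus SBminus.
- by move=> n; apply: split_parity.
- move=> n; apply: card_snakes_parity (odd_invB_alternating n).
  exact: odd_invB_toggle.
have SDE n : SD n = #|[set p in snakes n | ~~ odd (negs p)]|.
  by apply: eq_card => p; rewrite !inE.
have SBDE n : SBD n = #|[set p in snakes n | odd (negs p)]|.
  by apply: eq_card => p; rewrite !inE negbK andbC.
have [||egf_D egf_BD] := @egf_snakes_parity SD SBD; last by split.
- by move=> n; rewrite SDE SBDE; apply: split_parity.
- move=> n; rewrite SDE SBDE.
  apply: card_snakes_parity (odd \o @negs n) _ _; first exact: odd_negs_toggle.
  by rewrite /= negs_alternating.
Qed.
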